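(* Let $d$ be prime, $n\ge1$, $G$ positive and invertible over $\mathbb Z_d$, and $\rho,\sigma$ $n$-qudit states. Then $\rho\boxtimes\sigma$ has minimal entropy (i.e. is a pure state, $H(\rho\boxtimes\sigma)=0$) if and only if $\rho$ and $\sigma$ are pure stabilizer states whose stabilizer groups $S_1$ (of $\rho$) and $S_2$ (of $\sigma$) satisfy $$S_1=\{w(-g_{10}^{-1}g_{11}\vec p,\ g_{01}^{-1}g_{00}\vec q):\ w(\vec p,\vec q)\in S_2\}$$ (as groups of Weyl operators up to phases).
   Context: Fix a prime $d$; $\chi(k)=e^{2\pi ik/d}$, $X|k\rangle=|k+1\rangle$, $Z|k\rangle=\chi(k)|k\rangle$ on $\mathbb C^d$; Weyl operators $w(p,q)=\chi(-2^{-1}pq)Z^pX^q$ (odd $d$), $w(p,q)=i^{-pq}Z^pX^q$ ($d=2$), $w(\vec p,\vec q)=\bigotimes_kw(p_k,q_k)$. A pure stabilizer state is (the projector onto) a common eigenvector of an abelian group of $d^n$ Weyl operators (up to phases), called its stabilizer group. $G=\begin{pmatrix}g_{00}&g_{01}\\ g_{10}&g_{11}\end{pmatrix}$ over $\mathbb Z_d$ with $\det G\not\equiv0$, $N=(\det G)^{-1}$; positive means all entries nonzero mod $d$. Key unitary $U|\vec i\rangle|\vec j\rangle=|Ng_{11}\vec i-Ng_{10}\vec j\rangle|-Ng_{01}\vec i+Ng_{00}\vec j\rangle$; convolution $\rho\boxtimes\sigma=\mathrm{Tr}_B[U(\rho\otimes\sigma)U^\dagger]$. $H$ is von Neumann entropy.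 *)

(* Defs.v *)
From HB Require Import structures.
From mathcomp Require Import all_boot all_order all_algebra.
From mathcomp Require Import reals trigo exp.
From mathcomp.real_closed Require Import complex.
Set Implicit Arguments.
Unset Strict Implicit.
Unset Printing Implicit Defensive.
Import Order.TTheory GRing.Theory Num.Theory.
Local Open Scope ring_scope.
Local Open Scope complex_scope.

(* computational basis labels of (C^d)^{(x)n} = vectors in Z_d^n *)
Notation vec d n := {ffun 'I_n -> 'F_d}.
(* labels (p, q) of n-qudit Weyl operators w(p, q) *)
Notation lbl d n := ({ffun 'I_n -> 'F_d} * {ffun 'I_n -> 'F_d})%type.

Section Qudits.
Variable R : realType.
Local Notation C := R[i].

(* operators on the Hilbert space with orthonormal basis indexed by T *)
Definition Op (T : finType) := 'M[C]_#|T|.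

Definition ent (T : finType) (A : Op T) (x y : T) : C :=
  A (enum_rank x) (enum_rank y).

Definition mkOp (T : finType) (f : T -> T -> C) : Op T :=
  \matrix_(i, j) f (enum_val i) (enum_val j).

Definition dag (m k : nat) (A : 'M[C]_(m, k)) : 'M[C]_(k, m) :=
  (map_mx (@conjc R) A)^T.

(* positive semidefinite: <v|A|v> >= 0 for all v (in the order of C,
   which includes being real) *)
Definition psd (T : finType) (A : Op T) : Prop :=
  forall v : 'cV[C]_#|T|, 0 <= (dag v *m A *m v) ord0 ord0.

Definition is_state (T : finType) (A : Op T) : Prop :=
  psd A /\ \tr A = 1.

(* eigenvalues with algebraic multiplicity: the roots of the
   characteristic polynomial (C is algebraically closed) *)
Definition eigs (T : finType) (A : Op T) : seq C :=
  sval (closed_field_poly_normal (char_poly A)).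

Definition xlnx (x : R) : R := if x == 0 then 0 else x * ln x.

Definition vN_entropy (T : finType) (A : Op T) : R :=
  - \sum_(z <- eigs A) xlnx (complex.Re z).

Definition tens (T1 T2 : finType) (A : Op T1) (B : Op T2) : Op (T1 * T2)%type :=
  mkOp (fun x y => ent A x.1 y.1 * ent B x.2 y.2).

Definition ptrB (T1 T2 : finType) (M : Op (T1 * T2)%type) : Op T1 :=
  mkOp (fun x y => \sum_(b : T2) ent M (x, b) (y, b)).

Variables d n : nat.

Local Notation vec := (vec d n).
Local Notation lbl := (lbl d n).

Definition chi (k : 'F_d) : C :=
  (cos (2 * pi * (val k)%:R / d%:R)) +i* (sin (2 * pi * (val k)%:R / d%:R)).

Definition wphase (p q : 'F_d) : C :=
  if d == 2%N then (0 +i* 1) ^- (val p * val q)%N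
  else chi (- (2%:R)^-1 * p * q).

(* <k'| w(p,q) |k> where w(p,q) = phase * Z^p X^q,
   X|k> = |k+1>, Z|k> = chi(k)|k>  (so Z^p X^q |k> = chi(p(k+q)) |k+q>) *)
Definition w1 (p q k' k : 'F_d) : C :=
  wphase p q * chi (p * k') * (k' == k + q)%:R.

Definition weyl (u : lbl) : Op vec :=
  mkOp (fun x y : vec => \prod_(k < n) w1 (u.1 k) (u.2 k) (x k) (y k)).

(* S (a set of Weyl labels, i.e. a group of Weyl operators up to phases)
   is the stabilizer group of the pure stabilizer state rho:
   S is a group of d^n Weyl operators (up to phases), they pairwise commute,
   and rho is the projector onto a (unit) common eigenvector of them. *)
Definition stabilizer_group_of (S : {set lbl}) (rho : Op vec) : Prop :=
  [/\ (0 : lbl) \in S,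
      {in S &, forall u v, u + v \in S},
      #|S| = (d ^ n)%N,
      {in S &, forall u v, weyl u *m weyl v = weyl v *m weyl u} &
      exists psi : 'cV[C]_#|vec|,
        [/\ dag psi *m psi = 1, rho = psi *m dag psi &
            {in S, forall u, exists lam : C, weyl u *m psi = lam *: psi}]].

Definition vscale (a : 'F_d) (v : vec) : vec := [ffun k => a * v k].

Definition g00 (G : 'M['F_d]_2) := G ord0 ord0.
Definition g01 (G : 'M['F_d]_2) := G ord0 ord_max.
Definition g10 (G : 'M['F_d]_2) := G ord_max ord0.
Definition g11 (G : 'M['F_d]_2) := G ord_max ord_max.

Definition positive_mx (G : 'M['F_d]_2) : Prop := forall i j, G i j != 0.

Definition Umap (G : 'M['F_d]_2) (ij : vec * vec) : vec * vec :=
  let N := (\det G)^-1 in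
  (vscale (N * g11 G) ij.1 - vscale (N * g10 G) ij.2,
   - vscale (N * g01 G) ij.1 + vscale (N * g00 G) ij.2).

Definition Uop (G : 'M['F_d]_2) : Op (vec * vec)%type :=
  mkOp (fun x y => (x == Umap G y)%:R).

Definition conv (G : 'M['F_d]_2) (rho sigma : Op vec) : Op vec :=
  ptrB (Uop G *m tens rho sigma *m dag (Uop G)).

Definition lbl_map (G : 'M['F_d]_2) (u : lbl) : lbl :=
  (vscale (- ((g10 G)^-1 * g11 G)) u.1, vscale ((g01 G)^-1 * g00 G) u.2).

End Qudits.

(* Main.v *)
(** The unitary [U] pulls a Weyl operator [w(p, q) (x) 1] back to a product of
    Weyl operators, so up to phases the characteristic function
    [Tr (A w(u))] of [conv G rho sigma] at [u] is the product of those of [rho]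
    and [sigma] at two rescaled labels.  By Parseval the squared moduli of the
    characteristic function of a state sum to [d ^ n] times its purity, and they
    are at most 1.  A state has entropy 0 iff its purity is 1; if this happens
    for the convolution, the sum over all labels of the products of the squared
    moduli for [rho] and [sigma] attains its maximal value [d ^ n], which
    forces both factors to be the same 0/1-valued function and both states to be
    pure.  The labels where the modulus is 1 are those whose Weyl operator has
    the state vector as an eigenvector, i.e. the stabilizer group. *)

Require Import Defs.
From HB Require Import structures.
From mathcomp Require Import all_boot all_order all_algebra.
From mathcomp Require Import reals trigo exp.
From mathcomp.real_closed Require Import complex.
From mathcomp Require Import ring lra spectral sesquilinear.
Set Implicit Arguments.
Unset Strict Implicit.
Unset Printing Implicit Defensive.
Import Order.TTheory GRing.Theory Num.Theory.
Local Open Scope ring_scope.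

(** * Adjoints, positive operators and the spectral theorem *)

Section Adjoint.
Variable R : realType.
Local Notation C := R[i].

Lemma dagE m k (A : 'M[C]_(m, k)) i j : dag A i j = (A j i)^*.
Proof. by rewrite !mxE. Qed.

Lemma dagK m k (A : 'M[C]_(m, k)) : dag (dag A) = A.
Proof. by apply/matrixP => i j; rewrite !dagE conjCK. Qed.

Lemma dagM m k l (A : 'M[C]_(m, k)) (B : 'M[C]_(k, l)) :
  dag (A *m B) = dag B *m dag A.
Proof. by rewrite /dag map_mxM trmx_mul. Qed.

Lemma dagB m k (A B : 'M[C]_(m, k)) : dag (A - B) = dag A - dag B.
Proof. by rewrite /dag map_mxB linearB. Qed.

Lemma dagZ m k c (A : 'M[C]_(m, k)) : dag (c *: A) = c^* *: dag A.
Proof. by rewrite /dag map_mxZ linearZ. Qed.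

Lemma dag1 m : dag (1%:M : 'M[C]_m) = 1%:M.
Proof. by apply/matrixP => i j; rewrite dagE !mxE conjC_nat eq_sym. Qed.

Lemma dag_delta m k (i : 'I_m) (j : 'I_k) :
  dag (delta_mx i j : 'M[C]_(m, k)) = delta_mx j i.
Proof. by apply/matrixP => a b; rewrite dagE !mxE andbC conjC_nat. Qed.

Lemma tr_dag m (A : 'M[C]_m) : \tr (dag A) = (\tr A)^*.
Proof. by rewrite /dag mxtrace_tr -trace_map_mx. Qed.

Lemma dag_mul_selfE m (v : 'cV[C]_m) (i j : 'I_1) :
  (dag v *m v) i j = \sum_k `|v k ord0| ^+ 2.
Proof.
rewrite !ord1 mxE; apply: eq_bigr => k _.
by rewrite dagE normCK mulrC.
Qed.

Lemma dag_mul_self_eq0 m (v : 'cV[C]_m) : (dag v *m v) ord0 ord0 = 0 -> v = 0.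
Proof.
rewrite dag_mul_selfE => /psumr_eq0P v0.
apply/matrixP => k j; rewrite ord1 mxE; apply/eqP.
by rewrite -normr_eq0 -sqrf_eq0 v0 // => ? _; rewrite exprn_ge0.
Qed.

End Adjoint.

(** * Positive semidefinite operators *)

Section States.
Variables (R : realType) (T : finType).
Local Notation C := R[i].
Implicit Types A B : Op R T.

Lemma psd_mul_dag k (B : 'M[C]_(#|T|, k)) : @psd R T (B *m dag B).
Proof.
move=> v; rewrite mulmxA -mulmxA -{1}(dagK B) -dagM dag_mul_selfE.
by apply: sumr_ge0 => i _; rewrite exprn_ge0.
Qed.

Lemma psd_conj (T' : finType) (A : Op R T') (M : 'M[C]_(#|T|, #|T'|)) :
  psd A -> @psd R T (M *m A *m dag M).
Proof.
move=> psdA v; have := psdA (dag M *m v).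
by rewrite dagM dagK !mulmxA.
Qed.

Lemma psd_trace_ge0 k A (M : 'M[C]_(#|T|, k)) :
  psd A -> 0 <= \tr (dag M *m A *m M).
Proof.
move=> psdA; apply: sumr_ge0 => i _.
have := psdA (col i M); congr (0 <= _).
rewrite !mxE; apply: eq_bigr => j _; rewrite !mxE; congr (_ * _).
by apply: eq_bigr => l _; rewrite !mxE.
Qed.

(* Polarization: testing positivity on e_i + e_j and on e_i + 'i e_j. *)
Lemma psd_hermitian A : psd A -> dag A = A.
Proof.
move=> psdA.
pose w (i j : 'I_#|T|) (c : C) : 'cV[C]_#|T| :=
  delta_mx i ord0 + c *: delta_mx j ord0.
have qE i j c : (dag (w i j c) *m A *m w i j c) ord0 ord0 =
    A i i + c * A i j + c^* * A j i + `|c| ^+ 2 * A j j.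
  have dd k := dag_delta R k (ord0 : 'I_1).
  have dw : dag (w i j c) = delta_mx ord0 i + c^* *: delta_mx ord0 j.
    by rewrite -!dd /w -dagZ /dag map_mxD linearD.
  have e (k l : 'I_#|T|) :
      delta_mx ord0 k *m A *m delta_mx l ord0 = (A k l)%:M :> 'M_1.
    by rewrite -rowE -colE; apply/matrixP => a b; rewrite !ord1 !mxE eqxx.
  rewrite dw /w !(mulmxDl, mulmxDr) -!(scalemxAl, scalemxAr) !e !mxE eqxx /=.
  by rewrite !mulr1n normCK; ring.
have Areal i : A i i \is Num.real.
  have := psdA (w i i 0); rewrite qE conjC0 normr0 expr0n /= !mul0r !addr0.
  exact: ger0_real.
have s1 i j : A i j + A j i \is Num.real.
  have /ger0_real := psdA (w i j 1); rewrite qE conjC1 normr1 expr1n !mul1r.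
  rewrite -addrA -addrA rpredDl ?Areal // addrA rpredDr ?Areal //.
have s2 i j : 'i * (A i j - A j i) \is Num.real.
  have /ger0_real := psdA (w i j 'i); rewrite qE conjCi normCi expr1n !mul1r.
  rewrite -addrA -addrA rpredDl ?Areal // addrA rpredDr ?Areal //.
  by rewrite mulrBr -mulNr.
apply/matrixP => i j; rewrite dagE.
have /CrealP := s1 i j; rewrite rmorphD /=.
have /CrealP := s2 i j; rewrite rmorphM rmorphB /= conjCi mulNr -mulrN.
move/(mulfI (neq0Ci _)) => h2 h1.
have : 2%:R * (A j i)^* = 2%:R * A i j.
  transitivity (((A i j)^* + (A j i)^*) - ((A i j)^* - (A j i)^*)); first by ring.
  rewrite h1 -[X in _ - X]opprK h2; ring.
by move/(mulfI _); apply; rewrite pnatr_eq0.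
Qed.

(** A positive operator is Hermitian, hence normal, hence unitarily diagonalizable. Testing
    positivity on [dag P *m delta_mx i ord0] makes the [i]-th eigenvalue nonnegative, so the
    eigenvalues can be given as reals. *)
Lemma psd_spectral A : psd A ->
  exists (P : 'M[C]_#|T|) (t : 'I_#|T| -> R),
  [/\ P *m dag P = 1%:M, A = dag P *m diag_mx (\row_i (t i)%:C%C) *m P
    & forall i, 0 <= t i].
Proof.
move=> psdA; have hA := psd_hermitian psdA.
have /hermitian_normalmx/orthomx_spectralP eA : A \is hermsymmx.
  by apply/is_hermitianmxP; rewrite expr0 scale1r -[LHS]hA /dag map_trmx.
have uP := spectral_unitarymx A.
set P := spectralmx A in eA uP; set s := spectral_diag A in eA.
have dagP : dag P = invmx P by rewrite invmx_unitary // /dag map_trmx.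
have PP : P *m dag P = 1%:M.
  by rewrite dagP mulmxV //; apply: unitarymx_unit.
have s0 i : 0 <= s ord0 i.
  have := psdA (dag P *m delta_mx i ord0).
  rewrite dagM dagK eA -dagP !mulmxA -(mulmxA _ P) PP mulmx1.
  rewrite -(mulmxA _ P) PP mulmx1.
  by rewrite dag_delta -rowE -colE !mxE eqxx.
exists P, (fun i => complex.Re (s ord0 i)); split => //.
  rewrite {1}eA dagP; congr (_ *m diag_mx _ *m _).
  apply/matrixP => i j; rewrite ord1 mxE complexRe; apply/esym/Creal_ReP.
  exact: ger0_real.
by move=> i; rewrite -lecR complexRe (Creal_ReP _ _) ?ger0_real.
Qed.

Lemma psd_factor A : psd A -> exists B, A = B *m dag B.
Proof.
move=> /psd_spectral [P [t [_ -> t0]]].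
pose D : 'M[C]_#|T| := diag_mx (\row_i (Num.sqrt (t i))%:C%C).
exists (dag P *m D); rewrite dagM dagK mulmxA -(mulmxA _ D) ; congr (_ *m _ *m _).
have -> : dag D = D.
  apply/matrixP => i j; rewrite dagE !mxE eq_sym; case: eqVneq => [->|_].
    by rewrite !mulr1n; exact: conjc_real.
  by rewrite !mulr0n conjC0.
rewrite mulmx_diag; congr diag_mx; apply/matrixP => i j.
by rewrite !mxE -rmorphM /= -expr2 sqr_sqrtr.
Qed.

End States.

(** * Purity and entropy *)

Section Purity.
Variables (R : realType) (T : finType).
Local Notation C := R[i].
Implicit Types A B : Op R T.

(** [eigs] lists roots of the characteristic polynomial, which unitary conjugation preserves; a
    factorization into monic linear factors is unique up to order. *)
Lemma eigs_unitary_diag (P : Op R T) (s : 'rV[C]_#|T|) :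
  P *m dag P = 1%:M ->
  perm_eq (eigs (dag P *m diag_mx s *m P : Op R T))
          [seq s ord0 i | i <- enum 'I_#|T|].
Proof.
move=> PP; rewrite /eigs; case: closed_field_poly_normal => r /=.
rewrite (monicP (char_poly_monic _)) scale1r => er.
apply: prod_XsubC_eq; rewrite -er big_map big_enum /=.
transitivity (char_poly (diag_mx s)); last first.
  rewrite char_poly_trig ?diag_mx_is_trig //.
  by apply: eq_bigr => i _; rewrite mxE eqxx.
rewrite /char_poly /char_poly_mx; set X := 'X%:M.
pose p : 'M[{poly C}]_#|T| := map_mx polyC P.
pose q : 'M[{poly C}]_#|T| := map_mx polyC (dag P).
have qp : q *m p = 1%:M by rewrite -map_mxM (mulmx1C PP) map_mx1.
have -> : X - map_mx polyC (dag P *m diag_mx s *m P) =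
          q *m (X - map_mx polyC (diag_mx s)) *m p.
  rewrite !map_mxM mulmxBr mulmxBl; congr (_ - _).
  by rewrite /X scalar_mxC -mulmxA qp mulmx1.
by rewrite !det_mulmx mulrAC -det_mulmx qp det1 mul1r.
Qed.

Lemma state_spectral A : is_state A ->
  exists (P : 'M[C]_#|T|) (t : 'I_#|T| -> R),
  [/\ P *m dag P = 1%:M, A = dag P *m diag_mx (\row_i (t i)%:C%C) *m P,
      forall i, 0 <= t i <= 1, \sum_i t i = 1
    & \tr (A *m A) = (\sum_i t i ^+ 2)%:C%C].
Proof.
move=> [/psd_spectral [P [t [PP eA t0]]] trA]; exists P, t.
have st : \sum_i t i = 1.
  apply: complexI; transitivity (\tr A); last by rewrite trA.
  rewrite eA mxtrace_mulC mulmxA PP mul1mx mxtrace_diag.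
  by rewrite rmorph_sum; apply: eq_bigr => i _; rewrite mxE.
split => //.
  move=> i; rewrite t0 /= -st (bigD1 i) //= lerDl.
  by apply: sumr_ge0.
rewrite eA !mulmxA -(mulmxA _ P) PP mulmx1 mxtrace_mulC !mulmxA PP mul1mx.
rewrite mulmx_diag mxtrace_diag rmorph_sum; apply: eq_bigr => i _.
by rewrite !mxE rmorphXn.
Qed.

(** The gap $1-\sum t_i^2$ equals $\sum t_i(1-t_i)$, whose terms are nonnegative. *)
Lemma sum_sqr_prob m (t : 'I_m -> R) :
  (forall i, 0 <= t i <= 1) -> \sum_i t i = 1 ->
  \sum_i t i ^+ 2 <= 1 /\
  (\sum_i t i ^+ 2 = 1 <-> forall i, t i = 0 \/ t i = 1).
Proof.
move=> t01 st.
have d0 i : 0 <= t i - t i ^+ 2 by have /andP[? ?] := t01 i; nra.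
have sd : \sum_i (t i - t i ^+ 2) = 1 - \sum_i t i ^+ 2 by rewrite sumrB st.
split; first by rewrite -subr_ge0 -sd sumr_ge0.
split => [s1 i|ti].
  have : \sum_i (t i - t i ^+ 2) = 0 by rewrite sd s1 subrr.
  move/psumr_eq0P => /(_ (fun i _ => d0 i) i isT) /eqP.
  rewrite expr2 -[X in X - _]mulr1 -mulrBr mulf_eq0 subr_eq0.
  by case/orP => /eqP <-; [left | right].
rewrite -st; apply: eq_bigr => i _.
by case: (ti i) => ->; rewrite ?expr0n ?expr1n.
Qed.

Lemma state_purity_le1 A : is_state A -> \tr (A *m A) <= 1.
Proof.
move=> /state_spectral [P [t [_ _ t01 st ->]]].
by rewrite (_ : 1 = (1 : R)%:C%C) // lecR; case: (sum_sqr_prob t01 st).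
Qed.

(** Purity 1 makes every eigenvalue 0 or 1; as they sum to 1, exactly one is 1, and [A] projects
    onto its eigenvector. *)
Lemma pure_state A : is_state A -> \tr (A *m A) = 1 ->
  exists psi : 'cV[C]_#|T|, dag psi *m psi = 1 /\ A = psi *m dag psi.
Proof.
move=> /state_spectral [P [t [PP eA t01 st ->]]] /complexI s1.
have ti := (sum_sqr_prob t01 st).2.1 s1.
have [i ti1] : exists i, t i = 1.
  case: (pickP (fun i => t i == 1)) => [i /eqP ?|no]; first by exists i.
  have : \sum_i t i = 0.
    apply: big1 => i _; case: (ti i) => // e1.
    by have := no i; rewrite e1 eqxx.
  by rewrite st => /eqP; rewrite oner_eq0.
have t0 j : j != i -> t j = 0.
  have : \sum_(j | j != i) t j = 0.
    by move: st; rewrite (bigD1 i) //= ti1 -[RHS]addr0 => /addrI.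
  move/psumr_eq0P => h ne; apply: h => // k _.
  by have /andP[] := t01 k.
have D : diag_mx (\row_i (t i)%:C%C) =
    delta_mx i ord0 *m dag (delta_mx i (ord0 : 'I_1)) :> 'M[C]_#|T|.
  rewrite dag_delta mul_delta_mx; apply/matrixP => a b; rewrite !mxE.
  case: (eqVneq a i) => [->|ai]; first by rewrite ti1 eq_sym.
  by rewrite t0 //= mul0rn.
exists (dag P *m delta_mx i ord0); rewrite dagM dagK; split.
  rewrite !mulmxA -(mulmxA _ P) PP mulmx1 dag_delta mul_delta_mx.
  by apply/matrixP => a b; rewrite !ord1 !mxE eqxx.
by rewrite eA D !mulmxA.
Qed.

Lemma xlnx_le0 (x : R) : 0 <= x <= 1 -> xlnx x <= 0.
Proof.
move=> /andP[x0 x1]; rewrite /xlnx; case: ifP => // _.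
by apply: mulr_ge0_le0 => //; exact: ln_le0.
Qed.

Lemma xlnx_eq0 (x : R) : 0 <= x <= 1 -> xlnx x = 0 <-> x = 0 \/ x = 1.
Proof.
move=> /andP[x0 x1]; rewrite /xlnx; split; last first.
  by case=> ->; rewrite ?eqxx // oner_eq0 ln1 mulr0.
case: (eqVneq x 0) => [|xn0 /eqP]; first by left.
rewrite mulf_eq0 (negPf xn0) /= => /eqP l0; right.
by rewrite -[x]lnK ?l0 ?expR0 // posrE lt_def xn0.
Qed.

(** Both sides say that every eigenvalue is 0 or 1: these are the zeros of $x\ln x$ on $[0,1]$ and
    the equality case of [sum_sqr_prob]. *)
Lemma entropy_eq0P A : is_state A -> vN_entropy A = 0 <-> \tr (A *m A) = 1.
Proof.
move=> /state_spectral [P [t [PP eA t01 st ->]]].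
have -> : vN_entropy A = - \sum_i xlnx (t i).
  rewrite /vN_entropy eA (perm_big _ (eigs_unitary_diag _ PP)) /=.
  by rewrite big_map big_enum; congr (- _); apply: eq_bigr => i _; rewrite mxE.
have [_ h] := sum_sqr_prob t01 st.
have -> : (\sum_i t i ^+ 2)%:C%C = 1 :> C <-> \sum_i t i ^+ 2 = 1.
  by split => [/complexI|->].
rewrite h -sumrN; split => [s0 i|ti].
  apply/xlnx_eq0 => //; apply/eqP; rewrite -oppr_eq0; apply/eqP.
  by move/psumr_eq0P: s0; apply => // j _; rewrite oppr_ge0 xlnx_le0.
by apply: big1 => i _; apply/eqP; rewrite oppr_eq0; apply/eqP/xlnx_eq0.
Qed.

End Purity.

(** * Tensor products, partial trace and the convolution *)

Section Entries.
Variable R : realType.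
Local Notation C := R[i].

Lemma ent_mkOp (T : finType) (f : T -> T -> C) x y : ent (mkOp f) x y = f x y.
Proof. by rewrite /ent mxE !enum_rankK. Qed.

Lemma op_ext (T : finType) (A B : Op R T) : ent A =2 ent B -> A = B.
Proof.
move=> h; apply/matrixP => i j.
by have := h (enum_val i) (enum_val j); rewrite /ent !enum_valK.
Qed.

Lemma sum_enum_rank (T : finType) (F : 'I_#|T| -> C) :
  \sum_i F i = \sum_(x : T) F (enum_rank x).
Proof. by apply: reindex; apply: onW_bij; exact: enum_rank_bij. Qed.

Lemma ent_mul (T : finType) (A B : Op R T) x y :
  ent (A *m B) x y = \sum_z ent A x z * ent B z y.
Proof. by rewrite /ent mxE sum_enum_rank. Qed.

Lemma ent_dag (T : finType) (A : Op R T) x y : ent (dag A) x y = (ent A y x)^*.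
Proof. by rewrite /ent dagE. Qed.

Lemma ent_scale (T : finType) c (A : Op R T) x y :
  ent (c *: A : Op R T) x y = c * ent A x y.
Proof. by rewrite /ent mxE. Qed.

Lemma ent_1 (T : finType) (x y : T) : ent (1%:M : Op R T) x y = (x == y)%:R.
Proof. by rewrite /ent mxE (inj_eq enum_rank_inj). Qed.

Lemma sum_pick (T : finType) (z : T) (F : T -> C) :
  \sum_w (w == z)%:R * F w = F z.
Proof.
rewrite (bigD1 z) //= eqxx mul1r big1 ?addr0 // => w /negPf->.
by rewrite mul0r.
Qed.

Lemma tr_ent (T : finType) (A : Op R T) : \tr A = \sum_x ent A x x.
Proof. by rewrite /mxtrace sum_enum_rank. Qed.

Lemma ent_tens (T1 T2 : finType) (A : Op R T1) (B : Op R T2) x y :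
  ent (tens A B) x y = ent A x.1 y.1 * ent B x.2 y.2.
Proof. by rewrite ent_mkOp. Qed.

Lemma tens_mul (T1 T2 : finType) (A A' : Op R T1) (B B' : Op R T2) :
  tens (A *m A') (B *m B') = tens A B *m tens A' B'.
Proof.
apply: op_ext => x y; rewrite ent_tens !ent_mul big_distrlr pair_bigA /=.
by apply: eq_bigr => -[z1 z2] _; rewrite !ent_tens /= mulrACA.
Qed.

Lemma tens_dag (T1 T2 : finType) (A : Op R T1) (B : Op R T2) :
  tens (dag A) (dag B) = dag (tens A B).
Proof. by apply: op_ext => x y; rewrite ent_dag !ent_tens !ent_dag rmorphM. Qed.

Lemma psd_tens (T1 T2 : finType) (A : Op R T1) (B : Op R T2) :
  psd A -> psd B -> psd (tens A B).
Proof.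
move=> /psd_factor [A' ->] /psd_factor [B' ->].
by rewrite tens_mul tens_dag; exact: psd_mul_dag.
Qed.

Lemma tr_tens (T1 T2 : finType) (A : Op R T1) (B : Op R T2) :
  \tr (tens A B) = \tr A * \tr B.
Proof.
rewrite !tr_ent big_distrlr pair_bigA /=.
by apply: eq_bigr => -[x1 x2] _; rewrite ent_tens.
Qed.

Lemma qform_ent (T : finType) (A : Op R T) (v : 'cV[C]_#|T|) :
  (dag v *m A *m v) ord0 ord0 =
  \sum_x \sum_y (v (enum_rank x) ord0)^* * ent A x y * v (enum_rank y) ord0.
Proof.
rewrite mxE sum_enum_rank exchange_big; apply: eq_bigr => y _.
rewrite mxE sum_enum_rank mulr_suml; apply: eq_bigr => x _.
by rewrite dagE.
Qed.

Lemma psd_ptrB (T1 T2 : finType) (M : Op R (T1 * T2)%type) :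
  psd M -> psd (ptrB M).
Proof.
move=> psdM v; rewrite qform_ent.
(* [w b] is $v\otimes|b\rangle$; the form of the partial trace at [v] is the sum over [b] of the
   forms of [M] at [w b]. *)
pose w b : 'cV[C]_#|{: T1 * T2}| :=
  \col_i (((enum_val i).2 == b)%:R * v (enum_rank (enum_val i).1) ord0).
have wE b x : w b (enum_rank x) ord0 = (x.2 == b)%:R * v (enum_rank x.1) ord0.
  by rewrite mxE enum_rankK.
suff -> : \sum_x \sum_y (v (enum_rank x) ord0)^* * ent (ptrB M) x y
    * v (enum_rank y) ord0 = \sum_b (dag (w b) *m M *m w b) ord0 ord0.
  by apply: sumr_ge0 => b _; exact: psdM.
have pick (b : T2) (F : T1 * T2 -> C) :
  \sum_x (x.2 == b)%:R * F x = \sum_x1 F (x1, b).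
  rewrite (eq_bigr (fun x => (x.2 == b)%:R * F (x.1, x.2))); last by case.
  rewrite -(pair_bigA _ (fun i j => (j == b)%:R * F (i, j))) /=.
  by apply: eq_bigr => x1 _; rewrite sum_pick.
under [RHS]eq_bigr => b _.
  rewrite qform_ent.
  under eq_bigr => x _.
    under eq_bigr => y _ do
      rewrite !wE rmorphM /= conjC_nat mulrCA -!mulrA.
    rewrite pick.
    rewrite -mulr_sumr.
    over.
  rewrite pick.
  over.
rewrite [RHS]exchange_big /=; apply: eq_bigr => x _.
rewrite [RHS]exchange_big /=; apply: eq_bigr => y _.
rewrite ent_mkOp mulr_sumr mulr_suml; apply: eq_bigr => b _.
by rewrite mulrA.
Qed.

Lemma tr_ptrB (T1 T2 : finType) (M : Op R (T1 * T2)%type) :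
  \tr (ptrB M) = \tr M.
Proof.
rewrite !tr_ent.
rewrite [RHS](eq_bigr (fun x => ent M (x.1, x.2) (x.1, x.2))); last by case.
rewrite -(pair_bigA _ (fun i j => ent M (i, j) (i, j))) /=.
by apply: eq_bigr => x _; rewrite ent_mkOp.
Qed.

End Entries.

Section Inverse22.
Variables (F : fieldType) (a b c e x y : F).
Hypothesis D : a * e - b * c != 0.
Let N := (a * e - b * c)^-1.

(** With [a], [b], [c], [e] in the roles of [g00], [g01], [g10], [g11], the four identities are the
    coordinates of the two cancellations between [Umap] and [Uinv]. *)
Lemma inv22_row1 : a * (N * e * x - N * c * y) + c * (- (N * b * x) + N * a * y) = x.
Proof. by rewrite /N; field. Qed.

Lemma inv22_row2 : b * (N * e * x - N * c * y) + e * (- (N * b * x) + N * a * y) = y.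
Proof. by rewrite /N; field. Qed.

Lemma inv22_col1 : N * e * (a * x + c * y) - N * c * (b * x + e * y) = x.
Proof. by rewrite /N; field. Qed.

Lemma inv22_col2 : - (N * b * (a * x + c * y)) + N * a * (b * x + e * y) = y.
Proof. by rewrite /N; field. Qed.

End Inverse22.

(** * The convolution in coordinates *)

Section Convolution.
Variables (R : realType) (d n : nat) (G : 'M['F_d]_2).
Local Notation C := R[i].
Local Notation vec := (vec d n).
Hypothesis detG : \det G != 0.

(** Multiplication by the transpose of [G]; [Umap] multiplies by the inverse transpose. *)
Definition Uinv (ij : vec * vec) : vec * vec :=
  (vscale (g00 G) ij.1 + vscale (g10 G) ij.2,
   vscale (g01 G) ij.1 + vscale (g11 G) ij.2).

Lemma det2E : \det G = g00 G * g11 G - g01 G * g10 G.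
Proof.
rewrite (expand_det_row _ ord0) big_ord_recl big_ord1 /cofactor !det_mx11 !mxE.
rewrite expr0 expr1 mul1r mulN1r mulrN /g00 /g01 /g10 /g11.
by congr (G _ _ * G _ _ - G _ _ * G _ _); apply: val_inj.
Qed.

Lemma UmapK : cancel (Umap G) Uinv.
Proof.
case=> i j; rewrite /Uinv /Umap /=; have := detG; rewrite det2E => D.
by congr pair; apply/ffunP => k; rewrite !ffunE;
  rewrite ?(inv22_row1 _ _ D) ?(inv22_row2 _ _ D).
Qed.

Lemma UinvK : cancel Uinv (Umap G).
Proof.
case=> i j; rewrite /Uinv /Umap /=; have := detG; rewrite det2E => D.
by congr pair; apply/ffunP => k; rewrite !ffunE;
  rewrite ?(inv22_col1 _ _ D) ?(inv22_col2 _ _ D).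
Qed.

(** [Uop G] permutes the basis, so conjugating by it relabels entries through [Uinv]; the partial
    trace keeps the second label [b] equal on both sides. *)
Lemma ent_conv (rho sigma : Op R vec) x y :
  ent (conv G rho sigma) x y =
  \sum_b ent rho (Uinv (x, b)).1 (Uinv (y, b)).1 *
         ent sigma (Uinv (x, b)).2 (Uinv (y, b)).2.
Proof.
have U1 z w : (z == Umap G w) = (w == Uinv z).
  by rewrite eq_sym (can2_eq UmapK UinvK).
rewrite ent_mkOp; apply: eq_bigr => b _.
rewrite ent_mul.
under eq_bigr => w _.
  rewrite ent_dag ent_mkOp conjC_nat mulrC U1 ent_mul.
  under eq_bigr => u _ do rewrite ent_mkOp U1.
  rewrite sum_pick.
  over.
by rewrite sum_pick ent_tens.
Qed.

Lemma Uop_unitary : dag (Uop R n G) *m Uop R n G = 1%:M.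
Proof.
apply: op_ext => x y; rewrite ent_mul ent_1 (bigD1 (Umap G x)) //=.
rewrite ent_dag !ent_mkOp eqxx conjC1 mul1r (can_eq UmapK) big1 ?addr0 // => z.
by move/negPf => zx; rewrite ent_dag !ent_mkOp zx conjC0 mul0r.
Qed.

Lemma is_state_conv (rho sigma : Op R vec) :
  is_state rho -> is_state sigma -> is_state (conv G rho sigma).
Proof.
move=> [psdr trr] [psds trs]; split.
  by apply/psd_ptrB/psd_conj/psd_tens.
by rewrite tr_ptrB mxtrace_mulC mulmxA Uop_unitary mul1mx tr_tens trr trs mulr1.
Qed.

End Convolution.

(** * Weyl operators *)

Section Characters.
Variables (R : realType) (d : nat).
Local Notation C := R[i].
Hypothesis pd : prime d.
Local Notation chi := (@chi R d).

Let d_gt0 : (0 < d)%N. Proof. exact: prime_gt0. Qed.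

(** The point $e^{ix}$, through which [chi] becomes powers of a single [d]-th root of unity. *)
Definition cis (x : R) : C := Complex (cos x) (sin x).

Lemma cisD x y : cis (x + y) = cis x * cis y.
Proof.
rewrite /cis cosD sinD; apply/eqP; rewrite eq_complex /=; apply/andP.
by split; apply/eqP; ring.
Qed.

Lemma cis0 : cis 0 = 1.
Proof. by rewrite /cis cos0 sin0. Qed.

Lemma cis_natmul x k : cis (k%:R * x) = cis x ^+ k.
Proof.
elim: k => [|k IH]; first by rewrite mul0r cis0.
by rewrite exprS -IH -cisD -natr1 mulrDl mul1r addrC.
Qed.

Lemma cis_neq1 x : 0 < x < 2 * pi -> cis x != 1.
Proof.
move=> /andP[x0 x2]; rewrite /cis eq_complex /= negb_and; apply/orP; left.
(* Half angles: $\cos x=1-2\sin^2(x/2)$ with $x/2$ strictly between 0 and $\pi$. *)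
have s0 : 0 < sin (x / 2) by apply: sin_gt0_pi; lra.
rewrite (_ : x = x / 2 + x / 2); last by lra.
rewrite cosD -!expr2 cos2sin2; apply/eqP; nra.
Qed.

Let w := cis (2 * pi / d%:R).

Lemma chi_exp (k : 'F_d) : chi k = w ^+ val k.
Proof. by rewrite /w -cis_natmul /chi /cis; congr Complex; congr (_ _); ring. Qed.

Lemma wd1 : w ^+ d = 1.
Proof.
rewrite -cis_natmul mulrCA mulfV ?mulr1; last by rewrite pnatr_eq0 -lt0n.
by rewrite /cis mulr_natl cos2pi sin2pi.
Qed.

Lemma chiD a b : chi (a + b) = chi a * chi b.
Proof.
rewrite !chi_exp -exprD /=; set m := (_ + _)%N.
(* For prime [d] the modulus built into ['F_d] is [d] itself, and exponents of [w] matter only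
   modulo [d]. *)
by rewrite [X in (_ %% X)%N](Fp_cast pd) (expr_mod _ wd1).
Qed.

Lemma chi0 : chi 0 = 1.
Proof. by rewrite chi_exp expr0. Qed.

Lemma normr_chi a : `|chi a| = 1.
Proof.
suff w1 : `|w| = 1 by rewrite chi_exp normrX w1 expr1n.
by have /eqP := congr1 Num.norm wd1; rewrite normrX normr1 pexpr_eq1 // => /eqP.
Qed.

Lemma conj_chi a : (chi a)^* = chi (- a).
Proof.
have n0 : chi a != 0 by rewrite -normr_eq0 normr_chi oner_eq0.
by apply: (mulfI n0); rewrite -normCK normr_chi expr1n -chiD subrr chi0.
Qed.

Lemma chi_neq1 a : a != 0 -> chi a != 1.
Proof.
move=> a0; rewrite chi_exp -cis_natmul; apply: cis_neq1.
have dR : 0 < d%:R :> R by rewrite ltr0n.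
have a1 : (0 < val a)%N by rewrite lt0n; apply: contra a0 => /eqP h; apply/eqP/val_inj.
have a2 : (val a < d)%N by have := ltn_ord a; rewrite [X in (_ < X)%N](Fp_cast pd).
have := pi_gt0 R => pi0.
rewrite mulr_gt0 ?ltr0n ?divr_gt0 ?mulr_gt0 //=.
by rewrite mulrCA gtr_pMr ?mulr_gt0 // ltr_pdivrMr // mul1r ltr_nat.
Qed.

Variable n : nat.
Local Notation vec := (vec d n).

Definition chiv (p x : vec) : C := chi (\sum_k p k * x k).

Lemma chivDl p q x : chiv (p + q) x = chiv p x * chiv q x.
Proof.
rewrite /chiv -chiD -big_split; congr Defs.chi.
by apply: eq_bigr => k _; rewrite ffunE mulrDl.
Qed.

Lemma chivC p x : chiv p x = chiv x p.
Proof. by rewrite /chiv; congr Defs.chi; apply: eq_bigr => k _; rewrite mulrC. Qed.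

Lemma chivDr p x y : chiv p (x + y) = chiv p x * chiv p y.
Proof. by rewrite chivC chivDl !(chivC p). Qed.

Lemma normr_chiv p x : `|chiv p x| = 1.
Proof. exact: normr_chi. Qed.

Lemma chiv_conj_diff p x y : chiv p x * (chiv p y)^* = chiv p (x - y).
Proof.
rewrite chivDr /chiv conj_chi -sumrN; congr (_ * Defs.chi _ _).
by apply: eq_bigr => k _; rewrite ffunE mulrN.
Qed.

(** Orthogonality of characters: if [z k] is nonzero, translating [p] by the [k]-th unit vector
    leaves the sum unchanged, yet multiplies it by [chi (z k)], which is not 1. *)
Lemma sum_chiv z : \sum_(p : vec) chiv p z = (d ^ n)%:R *+ (z == 0).
Proof.
case: eqVneq => [->|z0].
  rewrite (eq_bigr (fun=> 1)); last first.
    by move=> p _; rewrite /chiv big1 ?chi0 // => k _; rewrite ffunE mulr0.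
  by rewrite sumr_const card_ffun card_Fp // card_ord.
have [k zk] : exists k, z k != 0.
  apply/existsP; apply: contraNT z0; rewrite negb_exists => /forallP h.
  by apply/eqP/ffunP => k; rewrite ffunE; have := h k; rewrite negbK => /eqP.
pose e : vec := [ffun j => (j == k)%:R].
have ez : chiv e z = chi (z k).
  rewrite /chiv (bigD1 k) //= ffunE eqxx mul1r big1 ?addr0 // => j /negPf jk.
  by rewrite ffunE jk mul0r.
apply/eqP; rewrite mulr0n; set S := \sum_p _.
have : chi (z k) * S = S.
  rewrite {2}/S (reindex_inj (addIr e)) mulr_sumr; apply: eq_bigr => p _.
  by rewrite chivDl ez mulrC.
move/eqP; rewrite -subr_eq0 -{2}[S]mul1r -mulrBl mulf_eq0 subr_eq0.
by rewrite (negPf (chi_neq1 zk)).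
Qed.

End Characters.

(** * Weyl operators and the Parseval identity *)

Section Weyl.
Variables (R : realType) (d n : nat).
Local Notation C := R[i].
Hypothesis pd : prime d.
Local Notation vec := (vec d n).
Local Notation lbl := (lbl d n).
Local Notation weyl := (@weyl R d n).
Local Notation chiv := (@chiv R d n).

(** Collecting the phases into one factor of modulus 1 treats $d=2$ and odd $d$ alike. *)
Definition wphasev (u : lbl) : C := \prod_k wphase R (u.1 k) (u.2 k).

Lemma normr_wphase (p q : 'F_d) : `|wphase R p q| = 1.
Proof.
rewrite /wphase; case: ifP => _; last exact: normr_chi.
by rewrite normrV ?unitfE ?expf_neq0 ?neq0Ci // normrX normCi expr1n invr1.
Qed.

Lemma normr_wphasev u : `|wphasev u| = 1.
Proof. by rewrite /wphasev normr_prod big1 // => k _; exact: normr_wphase. Qed.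

Lemma ent_weyl (u : lbl) x y :
  ent (weyl u) x y = wphasev u * chiv u.1 x * (x == y + u.2)%:R.
Proof.
rewrite ent_mkOp /w1 !big_split /=; congr (_ * _ * _).
  rewrite /chiv; elim/big_rec2: _ => [|k a b _ ->]; first by rewrite chi0.
  by rewrite chiD.
case: eqVneq => [->|xy]; first by rewrite big1 // => k _; rewrite ffunE eqxx.
have [k xk] : exists k, x k != y k + u.2 k.
  apply/existsP; apply: contraNT xy; rewrite negb_exists => /forallP h.
  by apply/eqP/ffunP => k; rewrite ffunE; have := h k; rewrite negbK => /eqP.
by rewrite (bigD1 k) //= (negPf xk) mul0r.
Qed.

Lemma weylM (u v : lbl) :
  exists2 c : C, c != 0 & weyl u *m weyl v = c *: weyl (u + v).
Proof.
have nz (c : C) : `|c| = 1 -> c != 0.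
  by move=> c1; rewrite -normr_eq0 c1 oner_eq0.
(* The conjugated character comes from moving the shift of [u] past the clock operator of [v]; the
   rest compares normalizing phases. *)
exists (wphasev u * wphasev v * (chiv v.1 u.2)^* / wphasev (u + v)).
  by rewrite !mulf_neq0 ?invr_neq0 ?conjC_eq0 // nz ?normr_wphasev ?normr_chiv.
apply: op_ext => x y; rewrite ent_mul ent_scale ent_weyl.
have e z : (x == z + u.2) = (z == x - u.2) by rewrite [RHS]eq_sym subr_eq.
under eq_bigr => z _ do rewrite !ent_weyl e -mulrA mulrCA.
rewrite sum_pick subr_eq -addrA (addrC v.2) chivDl // -chiv_conj_diff //=.
have := nz _ (normr_wphasev (u + v)); move: (wphasev _) => a a0.
by field.
Qed.

Lemma weyl_unitary u : dag (weyl u) *m weyl u = 1%:M.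
Proof.
apply: op_ext => x y; rewrite ent_mul ent_1.
have e z : ent (dag (weyl u)) x z * ent (weyl u) z y =
           (z == x + u.2)%:R * (z == y + u.2)%:R.
  rewrite ent_dag !ent_weyl; set P := wphasev u * _.
  have P1 : `|P| = 1 by rewrite normrM normr_wphasev normr_chiv // mulr1.
  rewrite rmorphM /= conjC_nat mulrACA [P^* * P]mulrC -normCK P1 expr1n.
  by rewrite mul1r.
by rewrite (eq_bigr _ (fun z _ => e z)) sum_pick (inj_eq (addIr _)).
Qed.

Definition charfun (A : Op R vec) (u : lbl) : C := \tr (A *m weyl u).

(** Up to a phase, the characteristic function is the Fourier transform in [u.1] of the diagonal of
    [A] at offset [u.2]. *)
Lemma norm_charfun A u : `|charfun A u| =
  `|\sum_(x : vec) ent A x (x + u.2) * chiv u.1 (x + u.2)|.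
Proof.
have -> : charfun A u =
    wphasev u * \sum_(x : vec) ent A (x - u.2) x * chiv u.1 x.
  rewrite /charfun tr_ent.
  under eq_bigr => x _.
    rewrite ent_mul.
    under eq_bigr => y _ do rewrite ent_weyl -subr_eq eq_sym mulrC -!mulrA.
    over.
  rewrite exchange_big mulr_sumr; apply: eq_bigr => y _ /=.
  rewrite (bigD1 (y - u.2)) //= eqxx mul1r big1 ?addr0 => [|x /negPf xy].
    by congr (_ * _); rewrite mulrC.
  by rewrite xy mul0r !mulr0.
rewrite normrM normr_wphasev mul1r (reindex_inj (addIr u.2)) /=.
by under eq_bigr do rewrite addrK.
Qed.

(** For a fixed shift [q], orthogonality in [p] kills the cross terms and leaves $d^n$ times the
    squared norm of the diagonal at offset [q]; these diagonals cover each entry of [A] once. *)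
Lemma parseval A :
  \sum_u `|charfun A u| ^+ 2 = (d ^ n)%:R * \tr (A *m dag A).
Proof.
rewrite -(pair_bigA _ (fun p q => `|charfun A (p, q)| ^+ 2)) exchange_big /=.
have sq (q : vec) : \sum_(p : vec) `|charfun A (p, q)| ^+ 2 =
    (d ^ n)%:R * \sum_(x : vec) `|ent A x (x + q)| ^+ 2.
  under eq_bigr => p _.
    rewrite norm_charfun normCK rmorph_sum big_distrlr /=.
    over.
  rewrite exchange_big /= mulr_sumr; apply: eq_bigr => x _.
  rewrite exchange_big (bigD1 x) //= [X in _ + X]big1 ?addr0 => [|y yx].
    under eq_bigr => p _ do rewrite rmorphM mulrACA -!normCK normr_chiv // expr1n mulr1.
    by rewrite sumr_const card_ffun card_Fp // card_ord mulr_natl.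
  under eq_bigr => p _.
    rewrite rmorphM mulrACA chiv_conj_diff // opprD addrACA subrr addr0.
    over.
  by rewrite -mulr_sumr sum_chiv // subr_eq0 eq_sym (negPf yx) mulr0.
under eq_bigr do rewrite sq.
rewrite -mulr_sumr exchange_big tr_ent; congr (_ * _); apply: eq_bigr => x _.
rewrite ent_mul (reindex_inj (addrI (- x))) /=; apply: eq_bigr => y _.
by rewrite addrA subrr add0r ent_dag -normCK.
Qed.

End Weyl.

(** * Characteristic functions *)

Section CharacteristicFunction.
Variables (R : realType) (d n : nat).
Local Notation C := R[i].
Hypothesis pd : prime d.
Local Notation vec := (vec d n).
Local Notation lbl := (lbl d n).
Implicit Types rho sigma : Op R vec.

Section OfConvolution.
Variable G : 'M['F_d]_2.
Hypothesis detG : \det G != 0.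

(* U^* (w(u) (x) 1) U = w(lblA u) (x) w(lblB u) *)
Definition lblA (u : lbl) : lbl :=
  (vscale ((\det G)^-1 * g11 G) u.1, vscale (g00 G) u.2).

Definition lblB (u : lbl) : lbl :=
  (vscale (- ((\det G)^-1 * g10 G)) u.1, vscale (g01 G) u.2).

Lemma chiv_scale (a : 'F_d) (p x : vec) :
  chiv R p (vscale a x) = chiv R (vscale a p) x.
Proof.
by rewrite /chiv; congr chi; apply: eq_bigr => k _; rewrite !ffunE mulrCA mulrA.
Qed.

Lemma vscaleN (a : 'F_d) (x : vec) : vscale (- a) x = - vscale a x.
Proof. by apply/ffunP => k; rewrite !ffunE mulNr. Qed.

Lemma vscaleDr (a : 'F_d) (x y : vec) :
  vscale a (x + y) = vscale a x + vscale a y.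
Proof. by apply/ffunP => k; rewrite !ffunE mulrDr. Qed.

(** Substituting [Umap G (i, j)] for the pair [(x, b)] turns the double sum into a product of
    independent sums over [i] and [j]. *)
Lemma norm_charfun_conv rho sigma u :
  `|charfun (conv G rho sigma) u| =
  `|charfun rho (lblA u)| * `|charfun sigma (lblB u)|.
Proof.
rewrite !norm_charfun // -normrM big_distrlr pair_bigA /=; congr `|_|.
under eq_bigr => x _ do rewrite ent_conv // mulr_suml.
rewrite pair_bigA /= (reindex_inj (can_inj (UmapK detG))).
apply: eq_bigr => -[i j] _.
have := UmapK detG (i, j); case: (Umap G (i, j)) => x b /= e.
(* Shifting [x] by [u.2] with [b] fixed shifts [i] and [j] by the second components of [lblA u] and
   [lblB u]. *)
have e' : Uinv G (x + u.2, b) = (i + vscale (g00 G) u.2, j + vscale (g01 G) u.2).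
  have [ei ej] : i = (Uinv G (x, b)).1 /\ j = (Uinv G (x, b)).2 by rewrite e.
  by rewrite ei ej /Uinv /= !vscaleDr; congr pair; rewrite addrAC.
(* Expressing [x + u.2] through the shifted [i] and [j] splits the character, with the first
   components of [lblA u] and [lblB u]. *)
have := UinvK detG (x + u.2, b); rewrite e' /Umap => /(congr1 fst) /= ex.
case: e e' => -> -> [-> ->]; rewrite -{}ex.
rewrite -vscaleN chivDr // !chiv_scale.
by rewrite mulrACA.
Qed.

End OfConvolution.

(** The value is $2-2\,\mathrm{Re}(c\,\mathrm{Tr}(AW))$: its positivity bounds the characteristic
    function, its vanishing detects eigenvectors. *)
Lemma tr_unitary_gap (T : finType) (A W : Op R T) c :
  is_state A -> dag W *m W = 1%:M -> `|c| = 1 ->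
  \tr (dag (1%:M - c *: W) *m A *m (1%:M - c *: W)) =
  2%:R - (c * \tr (A *m W) + (c * \tr (A *m W))^*).
Proof.
move=> [/psd_hermitian hA trA] W1 c1.
rewrite dagB dag1 dagZ mulmxBl mul1mx mulmxBr mulmx1 mulmxBl.
rewrite -!(scalemxAl, scalemxAr) scalerA -normCKC c1 expr1n scale1r.
rewrite !raddfB /= !mxtraceZ rmorphM /= -tr_dag dagM hA.
rewrite [\tr (dag W *m A *m W)]mxtrace_mulC mulmxA (mulmx1C W1) mul1mx trA.
by ring.
Qed.

Lemma phaseP (z : C) : exists2 c : C, `|c| = 1 & c * z = `|z|.
Proof.
case: (eqVneq z 0) => [->|z0]; first by exists 1; rewrite ?normr1 ?mulr0 ?normr0.
have nz : `|z| != 0 by rewrite normr_eq0.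
exists (z^* / `|z|); first by rewrite normrM norm_conjC normfV normr_id divff.
by rewrite mulrAC -normCKC expr2 mulfK.
Qed.

(* Positivity of rho on the columns of 1 - c w(u), with the phase c chosen to
   make c Tr (rho w(u)) nonnegative. *)
Lemma charfun_le1 rho u : is_state rho -> `|charfun rho u| <= 1.
Proof.
move=> srho; have [c c1 cX] := phaseP (charfun rho u).
have := psd_trace_ge0 (1%:M - c *: weyl R u) srho.1.
rewrite (tr_unitary_gap srho (weyl_unitary R pd u) c1) -/(charfun rho u) cX.
rewrite (CrealP _) ?normr_real //; move: `|_| => a.
have -> : 2%:R - (a + a) = 2%:R * (1 - a) by ring.
by rewrite pmulr_rge0 ?ltr0n // subr_ge0.
Qed.

Lemma pure_charfun_eq1P rho (psi : 'cV[C]_#|vec|) u :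
  is_state rho -> dag psi *m psi = 1 -> rho = psi *m dag psi ->
  (exists lam : C, weyl R u *m psi = lam *: psi) <-> `|charfun rho u| = 1.
Proof.
move=> srho psi1 erho; split => [[lam e]|X1].
  have -> : charfun rho u = lam.
    rewrite /charfun erho -mulmxA mxtrace_mulC -mulmxA e -scalemxAr psi1.
    by rewrite mxtraceZ mxtrace1 mulr1.
  apply/eqP; rewrite -(@pexpr_eq1 _ _ 2) // normCK; apply/eqP.
  have : dag (weyl R u *m psi) *m (weyl R u *m psi) = 1.
    by rewrite dagM mulmxA -(mulmxA (dag psi)) weyl_unitary // mulmx1.
  rewrite e dagZ -scalemxAl -scalemxAr psi1 scalerA => /(congr1 mxtrace).
  by rewrite mxtraceZ mxtrace1 mulr1 mulrC.
have [c c1 cX] := phaseP (charfun rho u).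
have := tr_unitary_gap srho (weyl_unitary R pd u) c1.
rewrite -/(charfun rho u) cX X1 conjC1 subrr.
set M := 1%:M - _.
have -> : dag M *m rho *m M = (dag M *m psi) *m dag (dag M *m psi).
  by rewrite erho dagM dagK !mulmxA.
rewrite mxtrace_mulC => tr0.
(* [tr0] says that [dag M *m psi] has norm 0; applying the Weyl operator gives the eigenvalue
   equation with eigenvalue [c^*]. *)
have /(congr1 (mulmx (weyl R u))) : dag M *m psi = 0.
  by apply: dag_mul_self_eq0; move: tr0; rewrite /mxtrace big_ord1.
rewrite mulmx0 /M dagB dag1 dagZ mulmxBl mul1mx mulmxBr -scalemxAl -scalemxAr.
rewrite mulmxA (mulmx1C (weyl_unitary R pd u)) mul1mx => /eqP.
by rewrite subr_eq0 => /eqP; exists c^*.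
Qed.

Lemma charfun0 rho : is_state rho -> `|charfun rho 0| = 1.
Proof.
move=> [_ tr1]; rewrite norm_charfun // -(normr1 C) -tr1 tr_ent; congr `|_|.
apply: eq_bigr => x _; rewrite addr0 /chiv big1 ?chi0 ?mulr1 // => k _.
by rewrite ffunE mul0r.
Qed.

Lemma pure_state_stabilizer rho :
  is_state rho -> \tr (rho *m rho) = 1 ->
  (forall u, `|charfun rho u| = 0 \/ `|charfun rho u| = 1) ->
  stabilizer_group_of [set u : lbl | `|charfun rho u| == 1] rho.
Proof.
move=> srho pur c01; have [psi [psi1 erho]] := pure_state srho pur.
have eigP u := pure_charfun_eq1P u srho psi1 erho.
have psi0 : psi != 0.
  by apply: contra_eq_neq psi1 => ->; rewrite mulmx0 eq_sym oner_neq0.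
(* Eigenvalues are nonzero because Weyl operators are invertible; they get cancelled in the
   commutation argument. *)
have eig u : u \in [set u : lbl | `|charfun rho u| == 1] ->
  exists2 lam : C, lam != 0 & weyl R u *m psi = lam *: psi.
  rewrite inE => /eqP /eigP [lam e]; exists lam => //.
  apply: contraNneq psi0 => l0; move: e; rewrite l0 scale0r.
  move/(congr1 (mulmx (dag (weyl R u)))).
  by rewrite mulmxA weyl_unitary // mul1mx mulmx0 => ->.
split.
- by rewrite inE charfun0.
- move=> u v /eig [l l0 eu] /eig [m m0 ev]; rewrite inE; apply/eqP/eigP.
  have [c c0 e] := weylM R pd u v.
  exists (c^-1 * (l * m)); rewrite -scalerA.
  have -> : (l * m) *: psi = weyl R u *m weyl R v *m psi.
    by rewrite -mulmxA ev -scalemxAr eu scalerA mulrC.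
  by rewrite e -scalemxAl scalerA mulVf // scale1r.
(* At purity 1 the squared moduli, all 0 or 1, sum to $d^n$, and this sum counts the set. *)
- apply/eqP; rewrite -(eqr_nat C); apply/eqP.
  have := parseval pd rho; rewrite (psd_hermitian srho.1) pur mulr1 => <-.
  rewrite -sum1_card natr_sum big_mkcond /=; apply: eq_bigr => u _.
  rewrite inE; case: (c01 u) => ->; rewrite ?eqxx ?expr1n //.
  by rewrite eq_sym oner_eq0 expr0n.
(* Both products are multiples of [weyl R (u + v)] and act on [psi] by the same scalar, so the
   multiples agree. *)
- move=> u v /eig [l l0 eu] /eig [m m0 ev].
  have [c c0 e1] := weylM R pd u v; have [c' c'0 e2] := weylM R pd v u.
  suff cc : c = c' by rewrite e1 e2 cc addrC.
  have : (c^-1 * (l * m)) *: psi = (c'^-1 * (m * l)) *: psi.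
    rewrite -[LHS]scalerA -[RHS]scalerA.
    have -> : (l * m) *: psi = weyl R u *m weyl R v *m psi.
      by rewrite -mulmxA ev -scalemxAr eu scalerA mulrC.
    have -> : (m * l) *: psi = weyl R v *m weyl R u *m psi.
      by rewrite -mulmxA eu -scalemxAr ev scalerA mulrC.
    rewrite e1 e2 -!scalemxAl !scalerA !mulVf // !scale1r.
    by rewrite addrC.
  move/eqP; rewrite -subr_eq0 -scalerBl scaler_eq0 (negPf psi0) orbF subr_eq0.
  rewrite (mulrC m) => /eqP /(mulIf (mulf_neq0 l0 m0)); exact: invr_inj.
- exists psi; split=> // u /eig [lam _ e]; by exists lam.
Qed.

(** Labels in [S] already contribute $d^n$ to the Parseval sum, its total for a pure state, so all
    others contribute 0. *)
Lemma stabilizer_charfun S rho : is_state rho ->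
  stabilizer_group_of S rho -> forall u, `|charfun rho u| ^+ 2 = (u \in S)%:R.
Proof.
move=> srho [_ _ cS _ [psi [psi1 erho eig]]] u.
have S1 v : v \in S -> `|charfun rho v| ^+ 2 = 1.
  by move=> /eig /(pure_charfun_eq1P v srho psi1 erho) ->; rewrite expr1n.
have := parseval pd rho.
rewrite (psd_hermitian srho.1) {2 3}erho mulmxA -(mulmxA psi) psi1 mulmx1 -erho.
rewrite srho.2 mulr1 (bigID [in S]) /= (eq_bigr _ S1) sumr_const cS.
rewrite -[RHS]addr0 => /addrI /psumr_eq0P h.
case: (boolP (u \in S)) => [/S1 //|uS].
by apply: h => // v _; rewrite exprn_ge0.
Qed.

Lemma stabilizer_pure S rho :
  stabilizer_group_of S rho -> is_state rho -> \tr (rho *m rho) = 1.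
Proof.
move=> [_ _ _ _ [psi [psi1 erho _]]] srho.
by rewrite {1 2}erho mulmxA -(mulmxA psi) psi1 mulmx1 -erho srho.2.
Qed.

End CharacteristicFunction.

(** * The saturation argument *)

Section Saturation.
Variables (F : numFieldType) (I : finType).

(** Since $ab\le a$ and $ab\le b$ termwise, equality of the sums leaves no slack: $a=ab=b$, hence
    $a=a^2$. *)
Lemma sum_mul_saturated (a b : I -> F) (D : F) :
  (forall u, 0 <= a u <= 1) -> (forall u, 0 <= b u <= 1) ->
  \sum_u a u <= D -> \sum_u b u <= D -> \sum_u a u * b u = D ->
  [/\ forall u, a u = b u, forall u, a u = 0 \/ a u = 1,
      \sum_u a u = D & \sum_u b u = D].
Proof.
move=> a01 b01 aD bD abD.
have a0 u : 0 <= a u by case/andP: (a01 u).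
have b0 u : 0 <= b u by case/andP: (b01 u).
have da u : 0 <= a u - a u * b u.
  by rewrite -{1}[a u]mulr1 -mulrBr mulr_ge0 // subr_ge0; case/andP: (b01 u).
have db u : 0 <= b u - a u * b u.
  by rewrite -{1}[b u]mul1r -mulrBl mulr_ge0 // subr_ge0; case/andP: (a01 u).
have sa : \sum_u (a u - a u * b u) = 0.
  by apply/eqP; rewrite eq_le sumr_ge0 // andbT sumrB abD subr_le0.
have sb : \sum_u (b u - a u * b u) = 0.
  by apply/eqP; rewrite eq_le sumr_ge0 // andbT sumrB abD subr_le0.
have ea u : a u = a u * b u.
  by apply/eqP; rewrite -subr_eq0; apply/eqP; move/psumr_eq0P: sa; apply.
have eb u : b u = a u * b u.
  by apply/eqP; rewrite -subr_eq0; apply/eqP; move/psumr_eq0P: sb; apply.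
have eab u : a u = b u by rewrite ea -eb.
split => //.
- move=> u; have /eqP := ea u; rewrite -eab -{1}[a u]mulr1 -subr_eq0 -mulrBr.
  by rewrite mulf_eq0 subr_eq0 => /orP[] /eqP; [left | right].
- by rewrite -abD; apply: eq_bigr => u _; exact: ea.
- by rewrite -abD; apply: eq_bigr => u _; exact: eb.
Qed.

End Saturation.

(** * Rescalings of Weyl labels *)

Section LabelMaps.
Variables (d n : nat) (G : 'M['F_d]_2).
Hypotheses (posG : positive_mx G) (detG : \det G != 0).
Local Notation lbl := (lbl d n).

Lemma lbl_scale_bij (a b : 'F_d) : a != 0 -> b != 0 ->
  bijective (fun u : lbl => (vscale a u.1, vscale b u.2)).
Proof.
move=> a0 b0; exists (fun u : lbl => (vscale a^-1 u.1, vscale b^-1 u.2)) => -[p q].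
  by congr pair; apply/ffunP => k; rewrite !ffunE mulKf.
by congr pair; apply/ffunP => k; rewrite !ffunE mulVKf.
Qed.

(** Positivity of [G] enters here and in the next two lemmas: the scaling factors are built from its
    entries and so are nonzero. *)
Lemma lblA_bij : bijective (@lblA d n G).
Proof. by apply: lbl_scale_bij; rewrite ?mulf_neq0 ?invr_neq0 // posG. Qed.

Lemma lblB_bij : bijective (@lblB d n G).
Proof.
by apply: lbl_scale_bij; rewrite ?oppr_eq0 ?mulf_neq0 ?invr_neq0 // posG.
Qed.

Lemma lbl_map_bij : bijective (@lbl_map d n G).
Proof.
by apply: lbl_scale_bij; rewrite ?oppr_eq0 ?mulf_neq0 ?invr_neq0 // posG.
Qed.

(** Thus [lbl_map] is [lblA] after the inverse of [lblB]: it matches the labels of [sigma] and [rho]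
    that the convolution pairs. *)
Lemma lbl_map_lblB u : lbl_map G (lblB G u) = @lblA d n G u.
Proof.
have g10_0 : g10 G != 0 by exact: posG.
have g01_0 : g01 G != 0 by exact: posG.
congr pair; apply/ffunP => k; rewrite !ffunE.
  rewrite mulrA mulrNN; congr (_ * _).
  by rewrite mulrACA [g11 G * _]mulrC mulrACA mulVf // mul1r.
by rewrite mulrACA mulVf // mul1r.
Qed.

End LabelMaps.

Unset Implicit Arguments.

Theorem mainTheorem14 (R : realType) (d n : nat) (G : 'M['F_d]_2)
    (rho sigma : Op R (vec d n)) :
  prime d -> (1 <= n)%N ->
  positive_mx G -> \det G != 0 ->
  is_state rho -> is_state sigma ->
  (vN_entropy (conv G rho sigma) = 0 <->
   exists S1 S2 : {set lbl d n},
     [/\ stabilizer_group_of S1 rho, stabilizer_group_of S2 sigma &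
         S1 = [set lbl_map G u | u in S2]]).
Proof.
move=> pd _ posG detG srho ssigma.
have sconv := is_state_conv detG srho ssigma.
rewrite entropy_eq0P //.
(* The squared modulus for the convolution at [u] is [a u * b u]; the next three facts are Parseval
   for the convolution, [rho] and [sigma]. *)
pose a (u : lbl d n) := `|charfun rho (lblA G u)| ^+ 2.
pose b (u : lbl d n) := `|charfun sigma (lblB G u)| ^+ 2.
have dn0 : (d ^ n)%:R != 0 :> R[i] by rewrite pnatr_eq0 -lt0n expn_gt0 prime_gt0.
have sumab : \sum_u a u * b u =
    (d ^ n)%:R * \tr (conv G rho sigma *m conv G rho sigma).
  rewrite -{2}(psd_hermitian sconv.1) -(parseval pd); apply: eq_bigr => u _.
  by rewrite (norm_charfun_conv pd detG) exprMn.
have suma : \sum_u a u = (d ^ n)%:R * \tr (rho *m rho).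
  rewrite -{2}(psd_hermitian srho.1) -(parseval pd) [RHS](reindex (lblA G)) /a.
    by [].
  exact: onW_bij (lblA_bij n posG detG).
have sumb : \sum_u b u = (d ^ n)%:R * \tr (sigma *m sigma).
  rewrite -{2}(psd_hermitian ssigma.1) -(parseval pd) [RHS](reindex (lblB G)) /b.
    by [].
  exact: onW_bij (lblB_bij n posG detG).
have [gA fA gK] := lblA_bij n posG detG.
have [gB fB gBK] := lblB_bij n posG detG.
split=> [pure|[S1 [S2 [stab1 stab2 eS]]]].
  have sq01 tau u : is_state tau -> 0 <= `|@charfun R d n tau u| ^+ 2 <= 1.
    by move=> st; rewrite exprn_ge0 // exprn_ile1 // charfun_le1.
  (* Purity 1 of the convolution is the saturated case with bound $d^n$; purity at most 1 bounds the
     two single sums. *)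
  have [|||||ab a01 sa sb] := @sum_mul_saturated _ _ a b (d ^ n)%:R.
  - by move=> u; exact: sq01.
  - by move=> u; exact: sq01.
  - by rewrite suma ler_piMr ?ler0n ?state_purity_le1.
  - by rewrite sumb ler_piMr ?ler0n ?state_purity_le1.
  - by rewrite sumab pure mulr1.
  have purity1 (z : R[i]) : (d ^ n)%:R * z = (d ^ n)%:R -> z = 1.
    by rewrite -[RHS]mulr1 => /(mulfI dn0).
  have sq1 (z : R[i]) : 0 <= z -> (z ^+ 2 == 1) = (z == 1).
    by move=> z0; rewrite pexpr_eq1.
  have sq01P (z : R[i]) : 0 <= z -> z ^+ 2 = 0 \/ z ^+ 2 = 1 -> z = 0 \/ z = 1.
    move=> z0 [/eqP|/eqP]; first by rewrite sqrf_eq0 => /eqP; left.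
    by rewrite sq1 // => /eqP; right.
  have rho01 u : `|charfun rho u| = 0 \/ `|charfun rho u| = 1.
    by apply: sq01P => //; have := a01 (gA u); rewrite /a gK.
  have sigma01 u : `|charfun sigma u| = 0 \/ `|charfun sigma u| = 1.
    by apply: sq01P => //; have := a01 (gB u); rewrite ab /b gBK.
  exists [set u | `|charfun rho u| == 1], [set u | `|charfun sigma u| == 1].
  split.
  - by apply: pure_state_stabilizer => //; apply: purity1; rewrite -suma.
  - by apply: pure_state_stabilizer => //; apply: purity1; rewrite -sumb.
  (* Equality of [a] and [b] at [gB v] compares [sigma] at [v] with [rho] at [lbl_map G v]. *)
  have eq1 v : (`|charfun rho (lbl_map G v)| == 1) = (`|charfun sigma v| == 1).
    have := ab (gB v); rewrite /a /b -(lbl_map_lblB posG) gBK => e.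
    by rewrite -[LHS](sq1 _ (normr_ge0 _)) e (sq1 _ (normr_ge0 _)).
  have [h hK Kh] := lbl_map_bij n posG.
  apply/setP => u; rewrite -(Kh u) mem_imset ?inE ?eq1 //.
  exact: can_inj hK.
(* Conversely, [a] and [b] are the indicators of [S1] and [S2] pulled back by [lblA] and [lblB]. By
   [eS] they coincide, so [a u * b u = b u], and the convolution inherits the purity 1 of
   [sigma]. *)
rewrite (stabilizer_pure stab2 ssigma) in sumb.
apply: (mulfI dn0); rewrite -sumab -sumb; apply: eq_bigr => u _.
rewrite /a /b !(stabilizer_charfun pd _ stab1, stabilizer_charfun pd _ stab2) //.
rewrite eS -lbl_map_lblB // mem_imset.
  by case: (_ \in S2); rewrite ?mulr1 ?mulr0.
exact: bij_inj (lbl_map_bij n posG).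
Qed.
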